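(* Let $G$ be a finite simple graph with $s$ vertices $t_1,\ldots,t_s$ and $E(G)\neq\emptyset$, and let $I_c(G)\subset S=K[t_1,\ldots,t_s]$ be its ideal of covers. The following are equivalent: (a) ${\rm v}(I_c(G))=s-2$; (b) ${\rm v}(I_c(G))={\rm reg}(S/I_c(G))=\dim(S/I_c(G))=s-2$ and $G$ is a codi-graph; (c) every vertex cover of $G$ with the exchange property has exactly $s-1$ vertices; (d) ${\rm v}(I_c(H))=|V(H)|-2$ for every induced subgraph $H$ of $G$ with $E(H)\ne\emptyset$ (where $I_c(H)$ is taken in the polynomial ring on $V(H)$); (e) every induced subgraph $H$ of $G$ with $E(H)\neq\emptyset$ is connected; (f) $G$ is a complete multipartite graph.
   Context: $K$ is a field and $S$ has the standard grading. A vertex cover of $G$ is a subset of $V(G)$ meeting every edge; the ideal of covers $I_c(G)$ is generated by $\prod_{t_i\in C}t_i$ over all minimal vertex covers $C$ of $G$. A vertex cover $C$ has the exchange property if there is an edge $\{t_k,t_\ell\}$ with $t_k\in C$, $t_\ell\notin C$ and $(C\setminus\{t_k\})\cup\{t_\ell\}$ a vertex cover. For a graded ideal $I\subset S$, ${\rm v}(I)=\min\{d\ge 0: \exists f\in S_d,\ \exists\mathfrak p\in{\rm Ass}(I),\ (I\colon f)=\mathfrak p\}$. ${\rm reg}$ denotes Castelnuovo–Mumford regularity and $\dim$ Krull dimension. $G$ is a codi-graph if its complement $\overline{G}$ is disconnected. $G$ is complete multipartite if $G$ is the join $G_1*\cdots*G_k$, $k\ge2$, of pairwise vertex-disjoint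 graphs without edges (the join consists of the union of the $G_i$ together with all edges joining a vertex of $G_i$ with a vertex of $G_j$ for $i\ne j$). *)

(* Defs.v *)
From HB Require Import structures.
From mathcomp Require Import all_boot all_algebra.
From mathcomp Require Import mpoly.
Set Implicit Arguments. Unset Strict Implicit. Unset Printing Implicit Defensive.
Import GRing.Theory.
Local Open Scope ring_scope.

Section Ideals.
Variables (K : fieldType) (n : nat).
Local Notation S := {mpoly K[n]}.

Definition is_ideal (I : S -> Prop) : Prop :=
  [/\ I 0, (forall a b, I a -> I b -> I (a + b)) & (forall r a, I a -> I (r * a))].

Definition is_prime (P : S -> Prop) : Prop :=
  [/\ is_ideal P, ~ P 1 & (forall a b, P (a * b) -> P a \/ P b)].

Definition ideal_eq (I J : S -> Prop) : Prop := forall g, I g <-> J g.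

Definition gen_ideal (gs : seq S) : S -> Prop :=
  fun f => exists c : 'I_(size gs) -> S, f = \sum_(i < size gs) c i * gs`_i.

Definition colon (I : S -> Prop) (f : S) : S -> Prop := fun g => I (g * f).

Definition Ass (I : S -> Prop) (p : S -> Prop) : Prop :=
  is_prime p /\ exists f, ideal_eq p (colon I f).

Definition vnum_witness (I : S -> Prop) (d : nat) : Prop :=
  exists f : S, f \is d.-homog /\ exists p, Ass I p /\ ideal_eq (colon I f) p.

Definition is_vnumber (I : S -> Prop) (d : nat) : Prop :=
  vnum_witness I d /\ forall d', vnum_witness I d' -> (d <= d')%N.

Definition prime_chain (I : S -> Prop) (k : nat) : Prop :=
  exists c : nat -> (S -> Prop),
    (forall i, (i <= k)%N -> is_prime (c i) /\ forall f, I f -> c i f) /\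
    (forall i, (i < k)%N -> (forall f, c i f -> c i.+1 f) /\
                            exists f, c i.+1 f /\ ~ c i f).

Definition is_krull_dim_quot (I : S -> Prop) (k : nat) : Prop :=
  prime_chain I k /\ forall m, prime_chain I m -> (m <= k)%N.

(* Graded free resolutions of S/I of finite length:
   0 <- S/I <- F_0 = S <- F_1 <- ... <- F_len <- 0,
   F_{i+1} = (+)_{j < b i} S(-a i j), the map F_{i+1} -> F_i given (on column
   vectors) by the matrix D i, whose (j,k) entry is homogeneous of degree
   deg(k-th generator of F_{i+1}) - deg(j-th generator of F_i). *)
Definition rk (b : nat -> nat) (i : nat) : nat := if i is i'.+1 then b i' else 1%N.
Definition shift (a : nat -> nat -> nat) (i j : nat) : nat :=
  if i is i'.+1 then a i' j else 0%N.

Definition graded_free_resolution (I : S -> Prop) (len : nat) (b : nat -> nat)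
    (a : nat -> nat -> nat) (D : forall i, 'M[S]_(rk b i, rk b i.+1)) : Prop :=
  [/\
      (forall i, (len <= i)%N -> b i = 0%N),
      (forall i (j : 'I_(rk b i)) (k : 'I_(rk b i.+1)),
         D i j k = 0 \/
         ((shift a i j <= shift a i.+1 k)%N /\
          D i j k \is (shift a i.+1 k - shift a i j)%N.-homog)),
      (* augmentation: image of F_1 -> F_0 = S is I, so coker = S/I *)
      (forall f, I f <-> exists w : 'cV[S]_(rk b 1), f = (D 0 *m w) (@ord0 0) (@ord0 0))
    &
      (forall i (v : 'cV[S]_(rk b i.+1)),
         D i *m v = 0 <-> exists w, v = D i.+1 *m w)].

(* the resolution has all a_{ij} - i <= r (F_0 = S contributes 0) *)
Definition res_reg_le (b : nat -> nat) (a : nat -> nat -> nat) (r : nat) : Prop :=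
  forall i j, (j < b i)%N -> (a i j <= r + i.+1)%N.

Definition reg_bounded (I : S -> Prop) (r : nat) : Prop :=
  exists len b a D, @graded_free_resolution I len b a D /\ res_reg_le b a r.

(* reg(S/I) = r : minimum over graded free resolutions of max(a_ij - i);
   (the minimum is attained by the minimal graded free resolution). *)
Definition is_reg_quot (I : S -> Prop) (r : nat) : Prop :=
  reg_bounded I r /\ forall r', reg_bounded I r' -> (r <= r')%N.

End Ideals.

Section Graphs.
Variables (T : finType).

Definition simple_graph (e : rel T) : Prop := irreflexive e /\ ssrbool.symmetric e.

Definition has_edge (e : rel T) : Prop := exists u v, e u v.

Definition is_vcover (e : rel T) (C : {set T}) : bool :=
  [forall u, forall v, e u v ==> (u \in C) || (v \in C)].

Definition min_vcovers (e : rel T) : seq {set T} :=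
  enum [set C : {set T} | minset (is_vcover e) C].

Definition exchange_property (e : rel T) (C : {set T}) : Prop :=
  exists k l, [/\ e k l, k \in C, l \notin C & is_vcover e ((C :\ k) :|: [set l])].

Definition connected_graph (e : rel T) : Prop := forall u v, connect e u v.

Definition complement_graph (e : rel T) : rel T := fun u v => (u != v) && ~~ e u v.

Definition codi_graph (e : rel T) : Prop := ~ connected_graph (complement_graph e).

Definition complete_multipartite (e : rel T) : Prop :=
  exists (k : nat) (part : T -> 'I_k),
    [/\ (2 <= k)%N, (forall i, exists v, part v = i) & (forall u v, e u v = (part u != part v))].

Definition cover_monomial (K : fieldType) (C : {set T}) : {mpoly K[#|T|]} :=
  \prod_(v in C) 'X_(enum_rank v).

Definition Ic (K : fieldType) (e : rel T) : {mpoly K[#|T|]} -> Prop :=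
  gen_ideal [seq cover_monomial K C | C <- min_vcovers e].

End Graphs.

Definition induced (T : finType) (e : rel T) (A : {set T}) : rel {x : T | x \in A} :=
  fun x y => e (val x) (val y).

Arguments Ic {T} K e _.
Arguments cover_monomial {T} K C.
Arguments induced {T} e A _ _.

(* Main.v *)
Require Import Defs.
From HB Require Import structures.
From mathcomp Require Import all_boot all_algebra.
From mathcomp Require Import mpoly zify.
Set Implicit Arguments. Unset Strict Implicit. Unset Printing Implicit Defensive.
Import GRing.Theory.
Local Open Scope ring_scope.

(** All six conditions are equivalent to transitivity of non-adjacency: whenever
    [u v] is an edge, every vertex is adjacent to [u] or to [v].

    A polynomial lies in the ideal of covers iff the support of each of its
    monomials is a vertex cover.  If [(I : f)] is prime, it contains both variables
    of some edge [u v], and then the support [A] of some monomial of [f] is such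
    that [u v] is the only edge disjoint from [A]; conversely such an [A] gives
    [(I : t^A) = (t_u, t_v)].  Hence the v-number is the least size of such an [A],
    and it drops below [s - 2] iff some edge [u v] and vertex [w] induce a subgraph
    with the single edge [u v].

    For a complete multipartite graph the ideal of covers is generated by the
    products of all but one of [y_1, ..., y_k], [y_i] being the product of the
    variables of the [i]-th part, and its Hilbert--Burch resolution has all its
    syzygies in degree [s].  The dimension is obtained from the algebraic
    dependence of any [n + 1] polynomials in [n] variables. *)

(** * Prime ideals and finitely generated ideals *)

Section PrimeIdeals.
Variables (K : fieldType) (n : nat).
Implicit Types (P : {mpoly K[n]} -> Prop) (f g : {mpoly K[n]}).

Lemma ideal_sum P (I : Type) (r : seq I) (Q : pred I) (F : I -> {mpoly K[n]}) :
  is_ideal P -> (forall i, Q i -> P (F i)) -> P (\sum_(i <- r | Q i) F i).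
Proof. by case=> P0 PD _ PF; apply: big_ind. Qed.

Lemma prime_prod P (I : eqType) (r : seq I) (Q : pred I)
    (F : I -> {mpoly K[n]}) :
  is_prime P -> P (\prod_(i <- r | Q i) F i) ->
  exists i, [/\ i \in r, Q i & P (F i)].
Proof.
case=> _ P1 PM; elim: r => [|x r IH]; first by rewrite big_nil => /P1.
have tail : (exists i, [/\ i \in r, Q i & P (F i)]) ->
    exists i, [/\ i \in x :: r, Q i & P (F i)].
  by case=> i [ir Qi PFi]; exists i; rewrite inE ir orbT.
rewrite big_cons; case: ifP => [Qx|_] => [/PM[]|]; last by move/IH/tail.
  by move=> PFx; exists x; rewrite inE eqxx.
by move/IH/tail.
Qed.

Lemma prime_exp P f k : is_prime P -> P (f ^+ k) -> P f.
Proof.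
case=> _ P1 PM; elim: k => [|k IH]; first by rewrite expr0 => /P1.
by rewrite exprS => /PM[|/IH].
Qed.

Lemma prime_mpolyX P m : is_prime P -> P 'X_[m] ->
  exists i, m i != 0%N /\ P 'X_i.
Proof.
move=> Ppr; rewrite mpolyXE_id => /(prime_prod Ppr)[i [_ _ Pi]]; exists i.
case: eqP Pi => [->|_ /(prime_exp Ppr)] //.
by rewrite expr0; case: Ppr.
Qed.

Lemma gen_ideal_ideal (gs : seq {mpoly K[n]}) : is_ideal (gen_ideal gs).
Proof.
split=> [|a b [c ->] [d ->]|r a [c ->]].
- by exists (fun=> 0); rewrite big1 // => i _; rewrite mul0r.
- exists (fun i => c i + d i); rewrite -big_split.
  by apply: eq_bigr => i _; rewrite mulrDl.
- exists (fun i => r * c i); rewrite mulr_sumr.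
  by apply: eq_bigr => i _; rewrite mulrA.
Qed.

Lemma mem_gen_ideal (gs : seq {mpoly K[n]}) f : f \in gs -> gen_ideal gs f.
Proof.
move=> fgs; have lt_f : (index f gs < size gs)%N by rewrite index_mem.
exists (fun i => ((i : nat) == index f gs)%:R).
rewrite (bigD1 (Ordinal lt_f)) //= eqxx mul1r nth_index // big1 ?addr0 //.
by move=> i; rewrite -val_eqE /= => /negbTE ->; rewrite mul0r.
Qed.

Lemma gen_ideal_min P (gs : seq {mpoly K[n]}) :
  is_ideal P -> {in gs, forall g, P g} -> forall f, gen_ideal gs f -> P f.
Proof.
move=> Pid Pgs f [c ->]; apply: ideal_sum => // i _; case: Pid => _ _; apply.
by apply: Pgs; rewrite mem_nth.
Qed.

End PrimeIdeals.

(** * Ideals spanned by monomials *)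

Section MonomialIdeals.
Variables (K : fieldType) (n : nat).
Implicit Types (U V W : pred 'X_{1..n}) (f g : {mpoly K[n]}) (m : 'X_{1..n}).

Definition mono_ideal U f : Prop := {in msupp f, forall m, U m}.

Lemma mono_idealX U m : mono_ideal U 'X_[m] <-> U m.
Proof.
split=> [|Um m']; first by apply; rewrite msuppX inE.
by rewrite msuppX inE => /eqP ->.
Qed.

Lemma mono_ideal_ideal U :
  (forall m1 m2, U m2 -> U (m1 + m2)%MM) -> is_ideal (mono_ideal U).
Proof.
move=> Uup; split=> [m|f g If Ig m|r f If m]; first by rewrite msupp0.
  by move/msuppD_le; rewrite mem_cat => /orP[/If|/Ig].
by move/msuppM_le => /allpairsP[[m1 m2] /= [_ /If Um2 ->]]; apply: Uup.
Qed.

Lemma mono_ideal_min (I : {mpoly K[n]} -> Prop) U f :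
  is_ideal I -> (forall m, U m -> I 'X_[m]) -> mono_ideal U f -> I f.
Proof.
move=> Iid IX If; rewrite (mpolyE f) big_seq; apply: ideal_sum => // m /If Um.
by rewrite -mul_mpolyC; case: (Iid) => _ _; apply; apply: IX.
Qed.

(** The projection onto the span of the monomials in [U]; it serves both for primality and for the
    lower bound on the regularity. *)
Definition mrestr U f : {mpoly K[n]} :=
  \sum_(m <- msupp f | U m) f@_m *: 'X_[m].

Lemma mcoeff_mrestr U f m : (mrestr U f)@_m = if U m then f@_m else 0.
Proof.
rewrite /mrestr big_mkcond linear_sum /=.
have [mf|nmf] := boolP (m \in msupp f).
  rewrite (bigD1_seq m) ?msupp_uniq //= big1 => [|i /negbTE im].
    by rewrite addr0; case: ifP; rewrite ?mcoeff0 // mcoeffZ mcoeffX eqxx mulr1.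
  by case: ifP; rewrite ?mcoeff0 // mcoeffZ mcoeffX im mulr0.
rewrite (memN_msupp_eq0 nmf) if_same big_seq big1 // => i fi.
case: ifP; rewrite ?mcoeff0 // mcoeffZ mcoeffX.
by case: eqP fi nmf => [-> ->|]; rewrite ?mulr0.
Qed.

Lemma mrestr_eq0 U f : mono_ideal (fun m => ~~ U m) f <-> mrestr U f = 0.
Proof.
split=> [If|If0 m mf].
  apply/mpolyP => m; rewrite mcoeff_mrestr mcoeff0; case: ifP => // Um.
  by apply: memN_msupp_eq0; apply/negP => /If; rewrite Um.
apply/negP => Um; move: (congr1 (mcoeff m) If0).
by rewrite mcoeff_mrestr Um mcoeff0 => /eqP; rewrite mcoeff_eq0 mf.
Qed.

(** Compatibility is required only at [m] and over the two supports, so that the lemma also applies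
    inside an ideal and in bounded degree. *)
Lemma mcoeff_mrestrM U V W f g m :
  (forall m1 m2, m1 \in msupp f -> m2 \in msupp g -> m = (m1 + m2)%MM ->
     W m = U m1 && V m2) ->
  (mrestr W (f * g))@_m = (mrestr U f * mrestr V g)@_m.
Proof.
move=> UVW; rewrite mcoeff_mrestr !mcoeffM -[LHS]/(if W m then _ else _).
transitivity (\sum_(k : 'X_{1..n < (mdeg m).+1, (mdeg m).+1} |
    m == (k.1 + k.2)%MM) if W m then f@_k.1 * g@_k.2 else 0).
  by case: ifP => // _; rewrite big1.
apply: eq_bigr => -[m1 m2] /= /eqP Em; rewrite !mcoeff_mrestr.
have [fm|] := boolP ((m1 : 'X_{1..n}) \in msupp f); last first.
  by move/memN_msupp_eq0 ->; rewrite !if_same !mul0r if_same.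
have [gm|] := boolP ((m2 : 'X_{1..n}) \in msupp g); last first.
  by move/memN_msupp_eq0 ->; rewrite !if_same !mulr0 if_same.
by rewrite (UVW _ _ fm gm Em); case: (U m1); case: (V m2);
  rewrite ?mul0r ?mulr0.
Qed.

Lemma mrestrT f : mrestr predT f = f.
Proof. by apply/mpolyP => m; rewrite mcoeff_mrestr. Qed.

(** Deleting the monomials in [U] is multiplicative, since a product avoids [U] iff both factors do.
    The ideal is the kernel of this map into a domain. *)
Lemma mono_ideal_prime U :
  (forall m1 m2, U (m1 + m2)%MM = U m1 || U m2) -> ~~ U 0%MM ->
  is_prime (mono_ideal U).
Proof.
move=> UD U0; split=> [||a b].
- by apply: mono_ideal_ideal => m1 m2 Um2; rewrite UD Um2 orbT.
- by rewrite -mpolyX0 => /mono_idealX; rewrite (negbTE U0).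
have E f : mono_ideal U f <-> mrestr (predC U) f = 0.
  by rewrite -mrestr_eq0; split=> If m /If /=; rewrite negbK.
rewrite !E => ab0.
suff /esym/eqP : mrestr (predC U) (a * b) =
    mrestr (predC U) a * mrestr (predC U) b.
  by rewrite ab0 mulf_eq0 => /orP[] /eqP; [left|right].
apply/mpolyP => m; apply: mcoeff_mrestrM => m1 m2 _ _ -> /=.
by rewrite UD negb_or.
Qed.

Lemma mpoly_divX f (d : 'X_{1..n}) :
  mono_ideal (fun m => (d <= m)%MM) f -> exists g, f = g * 'X_[d].
Proof.
move=> df; exists (\sum_(m <- msupp f) f@_m *: 'X_[(m - d)%MM]).
rewrite {1}(mpolyE f) mulr_suml; apply: eq_big_seq => m mf.
by rewrite -scalerAl -mpolyXD submK // df.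
Qed.

End MonomialIdeals.

(** * Squarefree monomials and ideals generated by variables *)

Section SquarefreeMonomials.
Variable T : finType.
Implicit Types (m : 'X_{1..#|T|}) (A B C : {set T}).

Definition msup m : {set T} := [set v | m (enum_rank v) != 0%N].

Definition mset C : 'X_{1..#|T|} := [multinom (enum_val i \in C : nat) | i < #|T|].

Lemma msup0 : msup 0%MM = set0.
Proof. by apply/setP => v; rewrite !inE mnm0E. Qed.

Lemma msupD m1 m2 : msup (m1 + m2)%MM = msup m1 :|: msup m2.
Proof. by apply/setP => v; rewrite !inE mnmDE addn_eq0 negb_and. Qed.

Lemma msupU v : msup U_(enum_rank v)%MM = [set v].
Proof.
apply/setP => w; rewrite !inE mnm1E (inj_eq enum_rank_inj) [w == v]eq_sym.
by case: (v == w).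
Qed.

Lemma mset_le C m : (mset C <= m)%MM = (C \subset msup m).
Proof.
apply/mnm_lepP/subsetP => [le_m v vC|sCm i].
  by rewrite inE -lt0n; have := le_m (enum_rank v); rewrite mnmE enum_rankK vC.
rewrite mnmE; case: (boolP (_ \in C)) => // /sCm.
by rewrite inE enum_valK lt0n.
Qed.

Lemma msup_mset C : msup (mset C) = C.
Proof. by apply/setP => v; rewrite inE mnmE enum_rankK; case: (_ \in C). Qed.

Lemma mdeg_mset C : mdeg (mset C) = #|C|.
Proof.
rewrite mdegE -sum1_card (reindex enum_rank) /=; last first.
  by apply: onW_bij; apply: enum_rank_bij.
rewrite [RHS]big_mkcond /=; apply: eq_bigr => v _.
by rewrite mnmE enum_rankK; case: (v \in C).
Qed.

Lemma card_msup m : (#|msup m| <= mdeg m)%N.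
Proof.
have le_m : (mset (msup m) <= m)%MM by rewrite mset_le.
by rewrite -[X in (_ <= mdeg X)%N](submK le_m) mdegD mdeg_mset leq_addl.
Qed.

Lemma cover_monomialE (K : fieldType) C : cover_monomial K C = 'X_[mset C].
Proof.
rewrite mpolyXE_id (reindex enum_rank) /=; last first.
  by apply: onW_bij; apply: enum_rank_bij.
rewrite /cover_monomial big_mkcond /=; apply: eq_bigr => v _.
by rewrite mnmE enum_rankK; case: (v \in C).
Qed.

Definition var_ideal (K : fieldType) A : {mpoly K[#|T|]} -> Prop :=
  mono_ideal (fun m => ~~ [disjoint msup m & A]).

Lemma var_ideal_prime (K : fieldType) A : is_prime (@var_ideal K A).
Proof.
apply: mono_ideal_prime => [m1 m2|].
  by rewrite -!setI_eq0 msupD setIUl setU_eq0 negb_and.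
by rewrite msup0 negbK -setI_eq0 set0I.
Qed.

Lemma var_idealX (K : fieldType) A v :
  var_ideal A ('X_(enum_rank v) : {mpoly K[#|T|]}) <-> v \in A.
Proof.
by rewrite /var_ideal (mono_idealX _ _ U_(enum_rank v)%MM) msupU disjoints1 negbK.
Qed.

Lemma var_idealS (K : fieldType) A B (f : {mpoly K[#|T|]}) :
  A \subset B -> var_ideal A f -> var_ideal B f.
Proof.
by move=> sAB fA m /fA; apply: contra; apply: disjointWr.
Qed.

Lemma var_ideal_min (K : fieldType) A (I : {mpoly K[#|T|]} -> Prop) f :
  is_ideal I -> {in A, forall v, I 'X_(enum_rank v)} -> var_ideal A f -> I f.
Proof.
move=> Iid IA; apply: mono_ideal_min => // m /pred0Pn[v /andP[/= vm vA]].
have /submK <- : (U_(enum_rank v) <= m)%MM.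
  apply/mnm_lepP => i; rewrite mnm1E; case: eqP => // <-.
  by move: vm; rewrite inE -lt0n.
by rewrite mpolyXD; case: (Iid) => _ _; apply; apply: IA.
Qed.

End SquarefreeMonomials.

(** * The ideal of covers and its prime colon ideals *)

Section CoverIdeal.
Variables (K : fieldType) (T : finType) (e : rel T).
Implicit Types (C A : {set T}) (f : {mpoly K[#|T|]}).

Lemma is_vcoverP C :
  reflect (forall u v, e u v -> (u \in C) || (v \in C)) (is_vcover e C).
Proof.
apply: (iffP forallP) => [h u v|h u]; first by move/forallP: (h u) => /(_ v)/implyP.
by apply/forallP => v; apply/implyP/h.
Qed.

Lemma is_vcoverPn C :
  reflect (exists u v, [/\ e u v, u \notin C & v \notin C]) (~~ is_vcover e C).
Proof.
apply: (iffP idP) => [|[u [v [uv uC vC]]]]; last first.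
  by apply/is_vcoverP => /(_ u v uv); rewrite (negbTE uC) (negbTE vC).
rewrite negb_forall => /existsP[u]; rewrite negb_forall => /existsP[v].
by rewrite negb_imply negb_or => /and3P[]; exists u, v.
Qed.

Lemma is_vcoverS A C : A \subset C -> is_vcover e A -> is_vcover e C.
Proof.
move=> /subsetP sAC /is_vcoverP cA; apply/is_vcoverP => u v /cA.
by case/orP => /sAC ->; rewrite ?orbT.
Qed.

(** Every cover contains a minimal one, so a monomial supported on a cover is a multiple of a
    generator. *)
Lemma IcP f :
  Ic K e f <-> mono_ideal (fun m => is_vcover e (msup m)) f.
Proof.
split.
  apply: gen_ideal_min.
    apply: mono_ideal_ideal => m1 m2; rewrite msupD; apply: is_vcoverS.
    exact: subsetUr.
  move=> g /mapP[C]; rewrite mem_enum inE => /minsetP[cC _] ->.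
  by rewrite cover_monomialE; apply/mono_idealX; rewrite msup_mset.
apply: mono_ideal_min; first exact: gen_ideal_ideal.
move=> m /minset_exists[C minC sCm].
have /submK <- : (mset C <= m)%MM by rewrite mset_le.
rewrite mpolyXD; have [_ _] :=
  gen_ideal_ideal [seq cover_monomial K C | C <- min_vcovers e].
apply; apply: mem_gen_ideal; apply/mapP; exists C.
  by rewrite mem_enum inE.
by rewrite cover_monomialE.
Qed.

Lemma IcX m : Ic K e 'X_[m] <-> is_vcover e (msup m).
Proof. by rewrite IcP mono_idealX. Qed.

Lemma Ic_ideal : is_ideal (Ic K e).
Proof. exact: gen_ideal_ideal. Qed.

Lemma Ic_sub_var_ideal u v f : e u v -> Ic K e f -> var_ideal [set u; v] f.
Proof.
move=> uv /IcP If m /If /is_vcoverP/(_ _ _ uv) cuv; apply/pred0Pn.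
by case/orP: cuv => h; [exists u|exists v]; rewrite /= h !inE eqxx ?orbT.
Qed.

Lemma IcMX f m :
  Ic K e (f * 'X_[m]) <-> mono_ideal (fun m' => is_vcover e (msup m :|: msup m')) f.
Proof.
rewrite IcP; split=> If m'.
  by move=> fm'; rewrite -msupD; apply: If; rewrite (perm_mem (msuppMX _ _)) map_f.
by rewrite (perm_mem (msuppMX _ _)) => /mapP[m1 /If ? ->]; rewrite msupD.
Qed.

(* The variables lying in [P] are collected one at a time: as long as no edge
   joins two of them, their complement is a cover, so it contains another. *)
Lemma prime_cover_edge (P : {mpoly K[#|T|]} -> Prop) :
  is_prime P -> (forall f, Ic K e f -> P f) ->
  exists u v, [/\ e u v, P 'X_(enum_rank u) & P 'X_(enum_rank v)].
Proof.
move=> Ppr IP.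
suff grow A : {in A, forall v, P 'X_(enum_rank v)} ->
    exists u v, [/\ e u v, P 'X_(enum_rank u) & P 'X_(enum_rank v)].
  by apply: (grow set0) => v; rewrite inE.
have [k] := ubnP #|~: A|; elim: k A => // k IH A leA PA.
have [cA|/is_vcoverPn[u [v [uv]]]] := boolP (is_vcover e (~: A)); last first.
  by rewrite !inE !negbK => uA vA; exists u, v; split=> //; apply: PA.
have : P 'X_[mset (~: A)] by apply/IP/IcX; rewrite msup_mset.
case/(prime_mpolyX Ppr) => i [mi Pi].
have niA : enum_val i \notin A by move: mi; rewrite mnmE inE; case: (_ \in A).
apply: (IH (enum_val i |: A)).
  rewrite -ltnS; apply: leq_trans leA; rewrite ltnS; apply: proper_card.
  rewrite properEneq setCS subsetUr andbT.
  by apply/negP => /eqP/setP/(_ (enum_val i)); rewrite !inE eqxx niA.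
by move=> v /setU1P[->|/PA//]; rewrite enum_valK.
Qed.

(** For irreflexive [e], this says that [u v] is the only edge disjoint from [A]: such an edge must
    contain [u] and must contain [v]. *)
Definition sole_edge A u v : Prop :=
  [/\ e u v, u \notin A, v \notin A, is_vcover e (u |: A) & is_vcover e (v |: A)].

Lemma vnum_witness_sole_edge d : irreflexive e -> vnum_witness (Ic K e) d ->
  exists A u v, sole_edge A u v /\ (#|A| <= d)%N.
Proof.
move=> e_irr [f [fd [p [[ppr _] colp]]]].
have IcM r g : Ic K e g -> Ic K e (r * g) by case: Ic_ideal => _ _; apply.
have [g Ig|u [v [uv pu pv]]] := prime_cover_edge ppr.
  by apply/colp; rewrite /colon mulrC; apply: IcM.
(* Otherwise [f] lies in the ideal and [(I : f)] contains 1. *)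
have /allPn[m mf ncov] : ~~ all (fun m => is_vcover e (msup m)) (msupp f).
  apply/negP => /allP/IcP If; case: (ppr) => _ p1 _; apply: p1.
  by apply/colp; rewrite /colon mul1r.
have cov w : p 'X_(enum_rank w) -> is_vcover e (w |: msup m).
  by move/colp; rewrite /colon mulrC => /IcMX/(_ m mf); rewrite msupU.
exists (msup m), u, v; split; last by rewrite -(dhomog_mf fd mf) card_msup.
(* The missed edge [x y] contains both [u] and [v], which are distinct, so it is [u v] in one of its
   two orientations. *)
have [x [y [xy xm ym]]] := is_vcoverPn _ ncov.
have /is_vcoverP/(_ _ _ xy) := cov u pu.
have /is_vcoverP/(_ _ _ xy) := cov v pv.
rewrite !in_setU1 (negbTE xm) (negbTE ym) !orbF => /orP[]/eqP Ev /orP[]/eqP Eu.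
- by rewrite -Ev Eu e_irr in uv.
- by split=> //; first [exact: cov | rewrite -Eu | rewrite -Ev].
- by split=> //; first [exact: cov | rewrite -Eu | rewrite -Ev].
- by rewrite -Ev Eu e_irr in uv.
Qed.
End CoverIdeal.

(** * The v-number as a least cardinality *)

Section VNumber.
Variables (K : fieldType) (T : finType) (e : rel T).
Implicit Types (A C : {set T}).

(** Enlarging [A] by a set gives a cover iff that set meets [{u, v}], so the colon by [t^A] is the
    prime [(t_u, t_v)]. *)
Lemma sole_edge_vnum_witness A u v :
  sole_edge e A u v -> vnum_witness (Ic K e) #|A|.
Proof.
case=> uv uA vA cu cv; exists 'X_[mset A]; split.
  by rewrite dhomogX /= mdeg_mset.
have E : ideal_eq (colon (Ic K e) 'X_[mset A]) (@var_ideal T K [set u; v]).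
  move=> g; rewrite /colon IcMX msup_mset; split=> gI m /gI.
    move/is_vcoverP/(_ _ _ uv); rewrite !in_setU (negbTE uA) (negbTE vA) /=.
    by move=> h; apply/pred0Pn; case/orP: h => h; [exists u|exists v];
      rewrite /= h !inE eqxx ?orbT.
  case/pred0Pn => w /andP[/= wm]; rewrite !inE => /orP[]/eqP Ew; subst w.
    apply: is_vcoverS cu; apply/subsetP => x.
    by case/setU1P => [->|xA]; rewrite in_setU ?wm ?orbT // xA.
  apply: is_vcoverS cv; apply/subsetP => x.
  by case/setU1P => [->|xA]; rewrite in_setU ?wm ?orbT // xA.
exists (@var_ideal T K [set u; v]); split=> //; split; first exact: var_ideal_prime.
by exists 'X_[mset A] => g; rewrite E.
Qed.

Lemma setU1C (u : T) A : u |: ~: A = ~: (A :\ u).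
Proof. by apply/setP => x; rewrite !inE negb_and negbK. Qed.

Lemma is_vcoverC A :
  reflect {in A &, forall x y, ~~ e x y} (is_vcover e (~: A)).
Proof.
apply: (iffP (is_vcoverP _ _)) => h x y; last first.
  by move=> xy; rewrite !inE -negb_and; apply: contraL xy => /andP[]; apply: h.
by move=> xA yA; apply/negP => /h; rewrite !inE xA yA.
Qed.

Hypothesis e_simple : simple_graph e.
Hypothesis e_edge : has_edge e.

Let e_irr : irreflexive e. Proof. by case: e_simple. Qed.

Lemma edge_neq u v : e u v -> u != v.
Proof. by apply: contraTneq => ->; rewrite e_irr. Qed.

Lemma sole_edge_compl u v : e u v -> sole_edge e (~: [set u; v]) u v.
Proof.
move=> uv; split; rewrite ?inE ?eqxx ?orbT // setU1C; apply/is_vcoverC => x y;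
  move=> /setD1P[nx /set2P xuv] /setD1P[ny /set2P yuv]; move: nx ny;
  by case: xuv => ->; case: yuv => ->; rewrite ?eqxx ?e_irr.
Qed.

Lemma card_sole_edge A u v : sole_edge e A u v -> (#|A|.+2 <= #|T|)%N.
Proof.
case=> uv uA vA _ _; have := max_card (mem (u |: (v |: A))).
by rewrite !cardsU1 !inE (negbTE uA) (negbTE vA) (negbTE (edge_neq uv)).
Qed.

(** The complement of an edge is always such a set, and none is larger; hence the least size is
    [s - 2] iff all sizes are. *)
Lemma is_vnumber_codim2P : is_vnumber (Ic K e) (#|T| - 2) <->
  forall A u v, sole_edge e A u v -> #|A| = (#|T| - 2)%N.
Proof.
split=> [[_ vmin] A u v se|h].
  apply/eqP; rewrite eqn_leq (vmin _ (sole_edge_vnum_witness se)) andbT.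
  by have := card_sole_edge se; lia.
split=> [|d /(vnum_witness_sole_edge e_irr)[A [u [v [/h <-]]]] //].
case: e_edge => u [v /sole_edge_compl se].
by rewrite -(h _ _ _ se); apply: sole_edge_vnum_witness se.
Qed.

(** Take [A = C :\ k]: the covers [C] and its exchange are [k |: A] and [l |: A]. *)
Lemma exchange_propertyP C : is_vcover e C /\ exchange_property e C <->
  exists A u v, sole_edge e A u v /\ C = u |: A.
Proof.
split=> [[cC [k [l [kl kC lC cl]]]]|[A [u [v [[uv uA vA cu cv] ->]]]]].
  exists (C :\ k), k, l; rewrite setD1K //; split=> //; split=> //.
  - by rewrite !inE eqxx.
  - by rewrite !inE (negbTE lC) andbF.
  - by rewrite setD1K.
  by rewrite setUC.
split=> //; exists u, v; split=> //; first by rewrite !inE eqxx.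
  by rewrite in_setU1 negb_or vA andbT eq_sym edge_neq.
by rewrite setU1K // setUC.
Qed.

End VNumber.

(** * Transitivity of non-adjacency, in contrapositive form *)

Definition nonadj_trans (T : finType) (e : rel T) : Prop :=
  forall u v w, e u v -> e u w || e v w.

Section NonadjTrans.
Variables (T : finType) (e : rel T).
Hypothesis e_simple : simple_graph e.

Let e_irr : irreflexive e. Proof. by case: e_simple. Qed.
Let e_sym : ssrbool.symmetric e. Proof. by case: e_simple. Qed.

(** A vertex other than [u], [v] missing from [A] would be joined to one of them, giving a second
    edge disjoint from [A]. Conversely, a vertex [w] joined to neither can be left out of [A] as
    well, which yields size [s - 3]. *)
Lemma nonadj_trans_sole_edge : nonadj_trans e <->
  forall A u v, sole_edge e A u v -> #|A| = (#|T| - 2)%N.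
Proof.
split=> [star A u v se|h u v w uv].
  have := card_sole_edge e_simple se.
  case: se => uv uA vA /is_vcoverP cu /is_vcoverP cv lt_A.
  have nuv := edge_neq e_simple uv.
  suff -> : A = ~: [set u; v].
    by have := cardsC [set u; v]; rewrite cards2 nuv => <-; rewrite addKn.
  apply/setP => w; rewrite !inE; case: (boolP (w \in A)) => wA.
    by symmetry; apply/norP; split; apply: contraTneq wA => ->.
  apply/esym/negbTE; rewrite negbK; apply: contraT; rewrite negb_or.
  case/andP => wu wv; case/orP: (star _ _ w uv) => [/cv|/cu];
    rewrite !in_setU1 (negbTE wA) ?(negbTE uA) ?(negbTE vA) ?(negbTE nuv)
      ?(negbTE wu) ?(negbTE wv) //.
  by rewrite eq_sym (negbTE nuv).
apply: contraT; rewrite negb_or => /andP[nuw nvw].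
have wu : w != u by apply: contraNneq nvw => ->; rewrite e_sym.
have wv : w != v by apply: contraNneq nuw => ->.
have nuv := edge_neq e_simple uv.
have se : sole_edge e (~: [set u; v; w]) u v.
  split; rewrite ?inE ?eqxx ?orbT // setU1C; apply/is_vcoverC => x y;
    move=> /setD1P[nx xuvw] /setD1P[ny yuvw]; move: nx ny;
    by case/setUP: xuvw => [/set2P[]|/set1P] ->;
      case/setUP: yuvw => [/set2P[]|/set1P] ->;
      rewrite ?eqxx ?e_irr // => _ _; rewrite // e_sym.
have := card_sole_edge e_simple se.
have := cardsC [set u; v; w]; rewrite (h _ _ _ se) -setUA cardsU1 cards2.
rewrite !inE negb_or nuv [u == w]eq_sym wu [v == w]eq_sym wv /=.
by lia.
Qed.

Lemma nonadj_trans_connected : nonadj_trans e -> has_edge e -> connected_graph e.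
Proof.
move=> star [u [v uv]].
have cu w : connect e u w.
  case/orP: (star _ _ w uv) => [/connect1//|vw].
  by apply: connect_trans (connect1 uv) (connect1 vw).
move=> x y; apply: connect_trans (cu y).
by rewrite sym_connect_sym.
Qed.

End NonadjTrans.

(** * Induced subgraphs *)

Section InducedSubgraphs.
Variables (T : finType) (e : rel T).
Hypothesis e_simple : simple_graph e.

Let e_irr : irreflexive e. Proof. by case: e_simple. Qed.
Let e_sym : ssrbool.symmetric e. Proof. by case: e_simple. Qed.

Lemma induced_simple (A : {set T}) : simple_graph (induced e A).
Proof. by split=> [x|x y]; rewrite /induced ?e_irr // e_sym. Qed.

Lemma nonadj_trans_induced (A : {set T}) :
  nonadj_trans e -> nonadj_trans (induced e A).
Proof. by move=> star u v w; apply: star. Qed.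

(** Connectedness of the subgraph on [u], [v], [w] gives [w] a neighbour among [u] and [v]: the
    first vertex of a path from [w] to [u]. *)
Lemma induced_connected_nonadj_trans :
  (forall A : {set T}, has_edge (induced e A) -> connected_graph (induced e A)) ->
  nonadj_trans e.
Proof.
move=> h u v w uv; pose A := [set u; v; w].
have uA : u \in A by rewrite !inE eqxx.
have vA : v \in A by rewrite !inE eqxx orbT.
have wA : w \in A by rewrite !inE eqxx orbT.
have hA : has_edge (induced e A) by exists (exist _ u uA), (exist _ v vA).
(* An empty path means [w = u], which is adjacent to [v]. *)
case/connectP: (h A hA (exist _ w wA) (exist _ u uA)) => -[|x p] /=.
  by move=> _ [<-]; rewrite [e v u]e_sym uv orbT.
case/andP; rewrite /induced /= => wx _ _.
move: wx; case: x => x /= /setUP[/set2P[]|/set1P] ->; rewrite e_sym.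
- by move->.
- by move->; rewrite orbT.
by rewrite e_irr.
Qed.

End InducedSubgraphs.

(** * Complete multipartite graphs *)

Section Multipartite.
Variables (T : finType) (e : rel T).

Lemma complete_multipartite_nonadj_trans :
  complete_multipartite e -> nonadj_trans e.
Proof.
case=> k [part [_ _ eE]] u v w; rewrite !eE => uv.
by case: eqP => //= <-; rewrite eq_sym.
Qed.

(* The parts are the fibres of [v |-> neighbourhood of v]. *)
Lemma nonadj_trans_complete_multipartite :
  simple_graph e -> has_edge e -> nonadj_trans e -> complete_multipartite e.
Proof.
move=> [e_irr e_sym] [u0 [v0 uv0]] star.
pose N v := [set w | e v w]; pose Q := N @: setT.
have NQ v : N v \in Q by apply: imset_f.
have eN u v : e u v = (N u != N v).
  apply/idP/idP => [uv|].
    by apply/eqP => /setP/(_ v); rewrite !inE uv e_irr.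
  apply: contraNT => nuv; apply/eqP/setP => w; rewrite !inE.
  apply/idP/idP => [/(star _ _ v)|/(star _ _ u)].
    by rewrite (negbTE nuv) e_sym.
  by rewrite [e v u]e_sym (negbTE nuv) e_sym.
pose part v := enum_rank_in (NQ u0) (N v).
have partE u v : (part u == part v) = (N u == N v).
  apply/eqP/eqP => [/(congr1 enum_val)|]; last by rewrite /part => ->.
  by rewrite !enum_rankK_in.
exists #|Q|, part; split=> [|i|u v]; last by rewrite partE.
  have := subset_leq_card (_ : [set N u0; N v0] \subset Q).
  rewrite cards2 -eN uv0; apply; apply/subsetP => x /set2P[]->; exact: NQ.
have /imsetP[v _ Nv] := enum_valP i; exists v.
by apply: enum_val_inj; rewrite enum_rankK_in.
Qed.

(** Paths in the complement never leave a part, so they cannot join the ends of an edge. *)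
Lemma complete_multipartite_codi :
  has_edge e -> complete_multipartite e -> codi_graph e.
Proof.
move=> [u [v uv]] [k [part [_ _ eE]]] /(_ u v)/connectP[p].
elim: p u uv => [|w p IH] u uv /=;
  first by move=> _ vu; rewrite eE vu eqxx in uv.
case/andP => /andP[_]; rewrite eE negbK => /eqP uw pw; apply: IH => //.
by rewrite eE -uw -eE.
Qed.

End Multipartite.

(** * Algebraic dependence and chains of primes *)

Section KrullDimension.
Variables (K : fieldType) (n : nat).

Lemma mdeg_msupp_prod (m D : nat) (x : 'I_m -> {mpoly K[n]}) (b : 'I_m -> nat) :
  (forall i, {in msupp (x i), forall mm, (mdeg mm <= D)%N}) ->
  {in msupp (\prod_i x i ^+ b i), forall mm, (mdeg mm <= \sum_i b i * D)%N}.
Proof.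
move=> xD; pose le_deg (f : {mpoly K[n]}) d :=
  {in msupp f, forall mm, (mdeg mm <= d)%N}.
have le1 : le_deg 1 0%N by move=> mm; rewrite msupp1 inE => /eqP ->; rewrite mdeg0.
have leM f d g d' : le_deg f d -> le_deg g d' -> le_deg (f * g) (d + d')%N.
  move=> fd gd mm /msuppM_le/allpairsP[[m1 m2] /= [/fd d1 /gd d2 ->]].
  by rewrite mdegD leq_add.
apply: (big_ind2 le_deg) => // i _.
elim: (b i) => [|k IH]; first by rewrite expr0.
by rewrite exprS mulSn; apply: leM => //; apply: xD.
Qed.

(* Among the [(N+1)^m] power products of the [x i] with exponents at most [N],
   only [O(N^q)] monomials in the [q < m] variables outside [A] occur, so for
   [N] large some nontrivial linear combination has none of them. *)
Lemma algebraic_dependence (A : {set 'I_n}) (m : nat) (x : 'I_m -> {mpoly K[n]}) :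
  (#|~: A| < m)%N ->
  exists (N : nat) (c : {ffun 'I_m -> 'I_N.+1} -> K),
    (exists b, c b != 0) /\
    forall mm : 'X_{1..n}, (forall i, i \in A -> mm i = 0%N) ->
      (\sum_b c b *: \prod_i x i ^+ b i)@_mm = 0.
Proof.
move=> lt_q; set q := #|~: A| in lt_q.
pose D := \max_i msize (x i).
have xD i : {in msupp (x i), forall mm, (mdeg mm <= D)%N}.
  move=> mm /msize_mdeg_lt/ltnW/leq_trans; apply.
  exact: (leq_bigmax (F := fun i => msize (x i))).
(* Chosen so that [(M+1)^q <= (c0 * (N+1))^q = N * (N+1)^q < (N+1)^(q+1)], where [M] bounds the
   degrees of all the power products. *)
pose c0 := (m * D).+1; pose N := (c0 ^ q)%N; pose M := (m * N * D)%N.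
pose V := {i : 'I_n | i \in ~: A}.
pose B := {ffun 'I_m -> 'I_N.+1}; pose G := {ffun V -> 'I_M.+1}.
have lt_GB : (#|{: G}| < #|{: B}|)%N.
  rewrite !card_ffun !card_ord card_sig.
  have -> : #|[pred i | i \in ~: A]| = q by apply: eq_card.
  apply: (@leq_trans (N.+1 ^ q.+1)%N); last by rewrite leq_pexp2l.
  apply: (@leq_ltn_trans ((c0 * N.+1) ^ q)%N).
    case: (posnP q) => [->|q0]; first by rewrite !expn0.
    by rewrite leq_exp2r // /M /c0; lia.
  by rewrite expnMn expnS ltn_pmul2r ?expn_gt0 // /N.
pose ext (g : G) : 'X_{1..n} :=
  [multinom if insub i is Some i' then (g i' : nat) else 0%N | i < n].
pose F (b : B) := \prod_i x i ^+ b i.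
pose Mx : 'M[K]_(#|{: B}|, #|{: G}|) :=
  \matrix_(r, s) (F (enum_val r))@_(ext (enum_val s)).
(* There are more rows than columns; a row of the left kernel supplies the coefficients. *)
have : kermx Mx != 0.
  rewrite -mxrank_eq0 mxrank_ker -lt0n subn_gt0.
  exact: leq_ltn_trans (rank_leq_col _) lt_GB.
case/rowV0Pn => v /sub_kermxP vM /matrix0Pn[z [j]]; rewrite ord1 => vj.
exists N, (fun b => v 0 (enum_rank b)); split.
  by exists (enum_val j); rewrite enum_valK.
move=> mm mmA; rewrite linear_sum /=.
have [small|big] := leqP (mdeg mm) M; last first.
  apply: big1 => b _; rewrite mcoeffZ memN_msupp_eq0 ?mulr0 //.
  apply/negP => /(mdeg_msupp_prod xD); apply/negP; rewrite -ltnNge.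
  apply: leq_ltn_trans big; rewrite -big_distrl leq_mul2r /M; apply/orP; right.
  apply: (@leq_trans (\sum_(i < m) N)%N); first by apply: leq_sum => i _; rewrite -ltnS.
  by rewrite sum_nat_const card_ord.
pose g : G := [ffun i => inord (mm (val i))].
have <- : ext g = mm.
  apply/mnmP => i; rewrite mnmE; case: insubP => [i' _ <-|].
    rewrite ffunE inordK // ltnS; apply: leq_trans small.
    by rewrite mdegE (bigD1 (val i')) //= leq_addr.
  by rewrite inE negbK => /mmA.
have := congr1 (fun w : 'rV_ _ => w 0 (enum_rank g)) vM.
rewrite !mxE => v0; rewrite -[RHS]v0.
rewrite [RHS](reindex enum_rank) /=; last by apply/onW_bij/enum_rank_bij.
by apply: eq_bigr => b _; rewrite mcoeffZ mxE !enum_rankK.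
Qed.

(* Take [x i] in [P i.+1] but not in [P i].  A relation among the [x i] modulo
   [P 0] is stripped of its variables one by one: dividing by the least power of
   [x j] occurring and reducing modulo [P j.+1] keeps exactly the terms of least
   exponent in [x j].  In the end a nonzero constant lies in [P m]. *)
Lemma prime_chain_independent (m N : nat) (P : nat -> {mpoly K[n]} -> Prop)
    (x : 'I_m -> {mpoly K[n]}) (c : {ffun 'I_m -> 'I_N.+1} -> K) :
  (forall i, (i <= m)%N -> is_prime (P i)) ->
  (forall i f, (i < m)%N -> P i f -> P i.+1 f) ->
  (forall i : 'I_m, P i.+1 (x i) /\ ~ P i (x i)) ->
  (exists b, c b != 0) -> ~ P 0%N (\sum_b c b *: \prod_i x i ^+ b i).
Proof.
move=> Ppr PS Px [b0 cb0] P0.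
pose F j (b : {ffun 'I_m -> 'I_N.+1}) := \prod_(i < m | (j <= i)%N) x i ^+ b i.
(* At stage [j] the tuples of [S] agree below [j], and the factors of index below [j] have been
   removed. *)
have strip j : (j <= m)%N -> exists S : {set {ffun 'I_m -> 'I_N.+1}},
    [/\ exists b, b \in S, {in S, forall b, c b != 0},
        {in S &, forall b b' : {ffun 'I_m -> 'I_N.+1},
           forall i : 'I_m, (i < j)%N -> b i = b' i} &
        P j (\sum_(b in S) c b *: F j b)].
  elim: j => [_|j IH lt_jm].
    exists [set b | c b != 0]; split=> [|b|//|]; first by exists b0; rewrite inE.
      by rewrite inE.
    move: P0; rewrite (bigID (fun b => c b != 0)) /= [X in _ + X]big1 ?addr0.
      rewrite (eq_bigl (fun b => b \in [set b | c b != 0])) // => b.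
      by rewrite inE.
    by move=> b; rewrite negbK => /eqP ->; rewrite scale0r.
  have [S [[b1 Sb1] cS eqS PS_j]] := IH (ltnW lt_jm).
  pose oj := Ordinal lt_jm.
  have [a Sa amin] : exists2 a, a \in S &
      forall b : {ffun 'I_m -> 'I_N.+1}, b \in S -> (a oj <= b oj)%N.
    have [a Sa amin] :=
      arg_minnP (fun b : {ffun 'I_m -> 'I_N.+1} => b oj : nat) Sb1.
    by exists a.
  have [Pj_id Pj1 PjM] := Ppr j (ltnW lt_jm).
  have [PSj_id _ _] := Ppr j.+1 lt_jm.
  pose R (b : {ffun 'I_m -> 'I_N.+1}) := x oj ^+ (b oj - a oj) * F j.+1 b.
  have FE b : b \in S -> F j b = x oj ^+ a oj * R b.
    move=> Sb; rewrite /R mulrA -exprD subnKC ?amin // /F (bigD1 oj) //=.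
    congr (_ * _); apply: eq_bigl => i; rewrite -val_eqE /=; lia.
  have PjR : P j (\sum_(b in S) c b *: R b).
    have : P j (x oj ^+ a oj * \sum_(b in S) c b *: R b).
      rewrite mulr_sumr; move: PS_j; congr (P j _); apply: eq_bigr => b Sb.
      by rewrite FE // scalerAr.
    by case/PjM => // /(prime_exp (Ppr j (ltnW lt_jm))); case: (Px oj).
  have {}PjR := PS _ _ lt_jm PjR.
  exists [set b in S | b oj == a oj]; split.
  - by exists a; rewrite inE Sa eqxx.
  - by move=> b; rewrite inE => /andP[/cS].
  - move=> b b'; rewrite !inE => /andP[Sb /eqP ba] /andP[Sb' /eqP b'a] i.
    rewrite ltnS leq_eqVlt => /orP[/eqP ij|]; last exact: eqS.
    by have -> : i = oj by [apply: val_inj]; rewrite ba b'a.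
  have PD f g : P j.+1 (f + g) -> P j.+1 g -> P j.+1 f.
    case: PSj_id => _ PD PM Pfg Pg; rewrite -(addrK g f); apply: PD => //.
    by rewrite -mulN1r; apply: PM.
  apply: (PD _ (\sum_(b in S | b oj != a oj) c b *: R b)).
    move: PjR; rewrite (bigID (fun b : {ffun 'I_m -> 'I_N.+1} => b oj == a oj)) /=.
    congr (P j.+1 (_ + _)); apply: eq_big => [b|b /andP[_ /eqP ba]].
      by rewrite inE.
    by rewrite /R ba subnn expr0 mul1r.
  (* A term with a larger exponent keeps a factor [x oj], which lies in [P j.+1]. *)
  apply: ideal_sum => // b /andP[Sb nba]; rewrite -mul_mpolyC /R.
  have : (0 < b oj - a oj)%N.
    by rewrite subn_gt0 ltn_neqAle amin // andbT eq_sym.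
  case: (b oj - a oj)%N => // k _; rewrite exprSr -!mulrA mulrCA mulrA.
  have [Pxj _] := Px oj; case: PSj_id => _ _ PM.
  by rewrite [x oj * _]mulrC mulrA; apply: (PM).
have [S [[b Sb] cS eqS]] := strip m (leqnn m).
(* All exponents now agree, so a single term remains, with an empty product. *)
have -> : S = [set b].
  apply/setP => b'; rewrite inE; apply/idP/eqP => [Sb'|-> //].
  by apply/ffunP => i; apply: eqS.
rewrite big_set1 /F big1 => [|i]; last by rewrite leqNgt ltn_ord.
have [[_ _ PM] P1 _] := Ppr m (leqnn m); move/(PM (c b)^-1%:MP).
by rewrite mul_mpolyC scalerA mulVf ?cS // scale1r.
Qed.

End KrullDimension.

(** * Krull dimension for the ideal of covers *)

Section CoverIdealDimension.
Variables (K : fieldType) (T : finType) (e : rel T).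
Hypothesis e_simple : simple_graph e.

Lemma card_edge_compl u v : e u v -> #|~: [set u; v]| = (#|T| - 2)%N.
Proof.
move=> uv; have := cardsC [set u; v]; rewrite cards2 (edge_neq e_simple uv).
by move=> <-; rewrite addKn.
Qed.

(** Start from [(t_u, t_v)] for an edge [u v] and adjoin the other variables one at a time. *)
Lemma Ic_prime_chain : has_edge e -> prime_chain (Ic K e) (#|T| - 2).
Proof.
case=> u [v uv]; pose s := enum (~: [set u; v]).
pose A i := [set u; v] :|: [set x in take i s].
exists (fun i => @var_ideal T K (A i)); split=> [i _|i lt_i].
  split; first exact: var_ideal_prime.
  by move=> f /(Ic_sub_var_ideal uv); apply: var_idealS; apply: subsetUl.
have lt_is : (i < size s)%N by rewrite -cardE (card_edge_compl uv).
split=> [f|].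
  apply: var_idealS; apply: setUS; apply/subsetP => x; rewrite !inE.
  by rewrite (take_nth u) // mem_rcons inE => ->; rewrite orbT.
exists 'X_(enum_rank (nth u s i)); split; first apply/var_idealX.
  by rewrite in_setU !inE (take_nth u) // mem_rcons mem_head !orbT.
move/var_idealX; rewrite in_setU => /orP[|].
  by apply/negP; rewrite -in_setC -mem_enum mem_nth.
rewrite inE => /(nthP u)[j]; rewrite size_takel ?(ltnW lt_is) // => lt_ji.
rewrite nth_take // => /eqP; rewrite nth_uniq ?enum_uniq ?(ltn_trans lt_ji) //.
by rewrite ltn_eqF.
Qed.

(** The smallest prime contains [t_u] and [t_v] for some edge. With more than [s - 2] steps, the
    chosen elements satisfy a nontrivial relation modulo [(t_u, t_v)], against their independence
    modulo that prime. *)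
Lemma Ic_prime_chain_le m : prime_chain (Ic K e) m -> (m <= #|T| - 2)%N.
Proof.
case=> P [Ppr Pchain].
have [u [v [uv Pu Pv]]] := prime_cover_edge (Ppr 0%N isT).1 (Ppr 0%N isT).2.
rewrite leqNgt; apply/negP => lt_m.
have [x Px] : exists x : 'I_m -> {mpoly K[#|T|]},
    forall i : 'I_m, P i.+1 (x i) /\ ~ P i (x i).
  have xP (i : 'I_m) : exists f, P i.+1 f /\ ~ P i f.
    by case: (Pchain i (ltn_ord i)).
  by have [x xE] := fin_all_exists xP; exists x.
have [|N [c [c0 cA]]] := @algebraic_dependence K _ (enum_rank @: [set u; v]) _ x.
  have : (2 + #|~: (enum_rank @: [set u; v])|)%N = #|T|.
    rewrite -[RHS]card_ord -(cardsC (enum_rank @: [set u; v])).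
    by rewrite (card_imset _ enum_rank_inj) cards2 (edge_neq e_simple uv).
  move=> cardE; apply: leq_ltn_trans lt_m.
  by rewrite -[X in (_ <= X - 2)%N]cardE addKn.
apply: (prime_chain_independent _ _ Px c0).
- by move=> i /Ppr[].
- by move=> i f /Pchain[h _]; apply: h.
apply: (@var_ideal_min T K [set u; v]); first by case: (Ppr 0%N isT).1.
  by move=> w /set2P[]->.
move=> m'; apply: contraTN => dis; rewrite -mcoeff_eq0; apply/eqP/cA.
move=> _ /imsetP[w wuv ->]; apply/eqP; rewrite -[_ == _]negbK.
by have := disjointFl dis wuv; rewrite inE => ->.
Qed.

Lemma Ic_krull_dim : has_edge e -> is_krull_dim_quot (Ic K e) (#|T| - 2).
Proof. by move=> /Ic_prime_chain; split=> // m /Ic_prime_chain_le. Qed.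

End CoverIdealDimension.

(** * Resolution and regularity for complete multipartite graphs *)

Section MultipartiteRegularity.
Variables (K : fieldType) (T : finType) (e : rel T).
Variables (p : nat) (part : T -> 'I_p.+1).
Hypothesis p_gt0 : (0 < p)%N.
Hypothesis part_surj : forall i, exists v, part v = i.
Hypothesis eE : forall u v, e u v = (part u != part v).

Local Notation S := {mpoly K[#|T|]}.
Local Notation V j := [set v | part v == j :> nat].
Local Notation X A := ('X_[mset A] : S).

(** Vertices missed by a cover are pairwise non-adjacent, hence all in one part; if none is missed,
    any part will do. *)
Lemma multipartite_vcoverP (A : {set T}) :
  reflect (exists i : 'I_p.+1, ~: V i \subset A) (is_vcover e A).
Proof.
apply: (iffP (is_vcoverP _ _)) => [cA|[i /subsetP sA] u v].
  have [v vA|A_all] := pickP (fun v => v \notin A).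
    exists (part v); apply/subsetP => w; rewrite !inE => vw.
    by have := cA v w; rewrite (negbTE vA) eE eq_sym; apply.
  by exists ord0; apply/subsetP => w _; have /negbFE := A_all w.
rewrite eE => uv; case: (boolP (part u == i)) => [/eqP ui|ui].
  by apply/orP; right; apply: sA; rewrite !inE -ui eq_sym.
by apply/orP; left; apply: sA; rewrite !inE.
Qed.

Lemma mset_compl (A : {set T}) : (mset A + mset (~: A))%MM = mset setT.
Proof.
by apply/mnmP => i; rewrite !mnmE !inE; case: (_ \in A).
Qed.

Lemma mulX_compl (A : {set T}) : X A * X (~: A) = X setT.
Proof. by rewrite -mpolyXD mset_compl. Qed.

Lemma mpolyX_neq0 (m : 'X_{1..#|T|}) : ('X_[m] : S) != 0.
Proof.
apply/eqP => /(congr1 (mcoeff m)); rewrite mcoeffX eqxx mcoeff0 => /eqP.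
by rewrite oner_eq0.
Qed.

Lemma mcoeffMX_eq0 (f : S) (d m : 'X_{1..#|T|}) :
  ~~ (d <= m)%MM -> (f * 'X_[d])@_m = 0.
Proof.
move=> ndm; apply/memN_msupp_eq0; rewrite (perm_mem (msuppMX _ _)).
by apply: contra ndm => /mapP[m' _ ->]; apply: lem_addr.
Qed.

(* The Hilbert--Burch resolution of the ideal of the products
   [prod_(l != j) y_l], where [y_l] is the product of the variables in part [l]. *)
Definition mp_rank i : nat := match i with 0 => p.+1 | 1 => p | _ => 0%N end.

Definition mp_shift i j : nat := if i is 0 then #|~: V j| else #|T|.

(** Column [k] of the second matrix is the syzygy comparing the [k]-th generator with the last: both
    become [t^T] when multiplied by their own [y]. *)
Definition mp_entry (i j k : nat) : S :=
  match i with
  | 0 => X (~: V k)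
  | 1 => if j == k then X (V k) else if j == p then - X (V p) else 0
  | _ => 0
  end.

Definition mp_diff i : 'M[S]_(rk mp_rank i, rk mp_rank i.+1) :=
  \matrix_(j, k) mp_entry i j k.

Lemma mp_diff0E (w : 'cV[S]_p.+1) i j :
  (mp_diff 0 *m w) i j = \sum_(l < p.+1) w l ord0 * X (~: V l).
Proof.
rewrite mxE; apply: eq_bigr => l _; rewrite mxE mulrC; congr (w l _ * _).
exact: ord1.
Qed.

Lemma mp_diff01 : mp_diff 0 *m mp_diff 1 = 0.
Proof.
apply/matrixP => i k; rewrite !mxE big_ord_recr /= !mxE /=.
rewrite (gtn_eqF (ltn_ord k)) eqxx (bigD1 k) //= !mxE /= eqxx.
rewrite big1 ?addr0 => [|j jk].
  by rewrite mulrN ![X (~: _) * _]mulrC !mulX_compl subrr.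
rewrite !mxE /= (ltn_eqF (ltn_ord j)).
by move: jk; rewrite -val_eqE /= => /negbTE ->; rewrite mulr0.
Qed.

(** Every variable of [y_i] divides all generators but the [i]-th, which forces [y_i] to divide
    [v_i]. The quotients [g_i] sum to zero, so the first [p] of them determine the last. *)
Lemma mp_diff0_ker (v : 'cV[S]_p.+1) :
  mp_diff 0 *m v = 0 -> exists w, v = mp_diff 1 *m w.
Proof.
move=> v0; have {}v0 : \sum_(l < p.+1) v l ord0 * X (~: V l) = 0.
  by rewrite -(mp_diff0E v ord0 ord0) v0 mxE.
have gP (i : 'I_p.+1) : exists g, v i ord0 = g * X (V i).
  apply: mpoly_divX => m vm; rewrite mset_le.
  apply: contraLR vm => /subsetPn[x xV xm]; rewrite -mcoeff_eq0.
  have := congr1 (mcoeff (mset (~: V i) + m)%MM) v0.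
  rewrite mcoeff0 linear_sum (bigD1 i) //= mcoeffMX big1 ?addr0 => [->//|j ji].
  apply: mcoeffMX_eq0; rewrite mset_le; apply/subsetPn; exists x.
    by move: xV; rewrite !inE => /eqP ->; rewrite eq_sym.
  rewrite msupD msup_mset in_setU !inE negb_or negbK.
  by move: xV xm; rewrite !inE => -> ->.
have [g gE] := fin_all_exists gP.
have g0 : \sum_(l < p.+1) g l = 0.
  apply: (mulIf (mpolyX_neq0 (mset setT))); rewrite mul0r -[RHS]v0 mulr_suml.
  by apply: eq_bigr => l _; rewrite gE -mulrA mulX_compl.
exists (\col_(j < p) g (widen_ord (leqnSn p) j)).
apply/matrixP => i j; rewrite ord1 gE mxE.
have [->|ip] := eqVneq i ord_max.
  have -> : g ord_max = - \sum_(l < p) g (widen_ord (leqnSn p) l).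
    by apply/eqP; rewrite -addr_eq0 addrC -[eqbRHS]g0 [eqbRHS]big_ord_recr.
  rewrite mulNr mulr_suml -sumrN; apply: eq_bigr => l _.
  by rewrite !mxE /= (gtn_eqF (ltn_ord l)) eqxx mulNr mulrC.
have lt_ip : (i < p)%N.
  by rewrite ltn_neqAle -ltnS ltn_ord andbT.
rewrite (bigD1 (Ordinal lt_ip)) //= big1 ?addr0 => [|l li].
  by rewrite !mxE /= eqxx mulrC; congr (_ * g _); apply: val_inj.
move: li; rewrite !mxE -val_eqE /= eq_sym => /negbTE ->.
by rewrite (ltn_eqF lt_ip) mul0r.
Qed.

(** The first [p] rows form a diagonal matrix with nonzero entries [y_i]. *)
Lemma mp_diff1_ker (v : 'cV[S]_p) : mp_diff 1 *m v = 0 -> v = 0.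
Proof.
move=> v0; apply/matrixP => i j; rewrite ord1 [RHS]mxE.
have := congr1 (fun w : 'cV[S]_p.+1 => w (widen_ord (leqnSn p) i) ord0) v0.
rewrite !mxE (bigD1 i) //= big1 ?addr0 => [|l li].
  rewrite !mxE /= eqxx => /eqP; rewrite mulf_eq0 (negbTE (mpolyX_neq0 _)) /=.
  by move/eqP.
move: li; rewrite !mxE -val_eqE /= eq_sym => /negbTE ->.
by rewrite (ltn_eqF (ltn_ord i)) mul0r.
Qed.

Lemma Ic_mp_diff0 (f : S) :
  Ic K e f <-> exists w : 'cV[S]_p.+1, f = (mp_diff 0 *m w) ord0 ord0.
Proof.
split=> [/IcP|[w ->]]; last first.
  rewrite mp_diff0E; apply: ideal_sum => [|i _]; first exact: Ic_ideal.
  case: (Ic_ideal K e) => _ _; apply; apply/IcX/multipartite_vcoverP.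
  by exists i; rewrite msup_mset.
pose I (g : S) := exists w : 'cV[S]_p.+1, g = (mp_diff 0 *m w) ord0 ord0.
apply: (mono_ideal_min (I := I)) => [|m /multipartite_vcoverP[i sim]].
  split=> [|f1 f2 [w1 ->] [w2 ->]|r f1 [w ->]].
  - by exists 0; rewrite mulmx0 mxE.
  - by exists (w1 + w2); rewrite mulmxDr [RHS]mxE.
  - by exists (r *: w); rewrite -scalemxAr [RHS]mxE.
exists (\col_l if l == i then 'X_[(m - mset (~: V i))%MM] else 0).
rewrite mp_diff0E (bigD1 i) //= big1 => [|l /negbTE li].
  by rewrite mxE eqxx addr0 -mpolyXD submK // mset_le.
by rewrite mxE li mul0r.
Qed.

Lemma mp_resolution :
  graded_free_resolution (Ic K e) 2 mp_shift mp_diff.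
Proof.
split.
- by case=> [|[]].
- case=> [|[|i]] j k; rewrite mxE; last by left.
    by right; split=> //=; rewrite subn0 dhomogX /= mdeg_mset.
  have -> : (shift mp_shift 2 k - shift mp_shift 1 j = #|V j|)%N.
    by rewrite /= -(cardsC (V j)) addnK.
  rewrite /= max_card.
  case: eqP => [<-|_]; first by right; rewrite dhomogX /= mdeg_mset.
  case: eqP => [->|_]; last by left.
  by right; rewrite dhomogN dhomogX /= mdeg_mset.
- exact: Ic_mp_diff0.
case=> [|[|i]] v; split.
- exact: mp_diff0_ker.
- by case=> w ->; rewrite mulmxA mp_diff01 mul0mx.
- by move/mp_diff1_ker => ->; exists 0; rewrite mulmx0.
- case=> w ->; apply/matrixP => j k; rewrite !mxE big1 // => l.
  by rewrite !mxE big_ord0 mulr0.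
- by move=> _; exists 0; apply/matrixP => -[].
by move=> _; apply/matrixP => j k; rewrite !mxE big_ord0.
Qed.

Lemma mp_shift_reg : res_reg_le mp_rank mp_shift (#|T| - 2).
Proof.
(* Makes the truncated subtraction [#|T| - 2] exact. *)
have two_le : (2 <= #|T|)%N.
  have [u pu] := part_surj ord0; have [v pv] := part_surj ord_max.
  apply: leq_trans (max_card (mem [set u; v])); rewrite cards2.
  suff -> : u != v by [].
  by apply: contraTneq p_gt0 => uv; move: pu; rewrite uv pv => -[->].
case=> [|[|i]] j //= lt_j; last by lia.
have [v pv] := part_surj (Ordinal lt_j).
have V_gt0 : (0 < #|V j|)%N by apply/card_gt0P; exists v; rewrite inE pv.
by rewrite addn1 -subSn // subSS cardsCs setCK leq_sub2l.
Qed.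

Lemma mp_card_compl (i : 'I_p.+1) : (#|~: V i| < #|T|)%N.
Proof.
have [v pv] := part_surj i; rewrite -(cardsC (V i)) -[ltnLHS]add0n ltn_add2r.
by apply/card_gt0P; exists v; rewrite inE pv.
Qed.

(* In degrees below [#|T|] every monomial of [Ic K e] is divisible by exactly one
   generator, so projecting onto the multiples of [X (~: V i)] is [S]-linear
   there.  If all syzygies were generated in those degrees, the projection would
   extend to the whole ideal, contradicting the syzygy between two generators,
   which lives in degree [#|T|]. *)
Let W (i : 'I_p.+1) (m : 'X_{1..#|T|}) := ~: V i \subset msup m.

Lemma mcoeff_mrestr_mp (i : 'I_p.+1) (f g : S) m :
  Ic K e f -> (mdeg m < #|T|)%N ->
  (mrestr (W i) f * g)@_m = if W i m then (f * g)@_m else 0.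
Proof.
move=> /IcP If lt_m; rewrite -(mcoeff_mrestr (W i)) -[in LHS](mrestrT g).
symmetry; apply: mcoeff_mrestrM => m1 m2 /If /multipartite_vcoverP[j sj] _ mE.
rewrite andbT; apply/idP/idP => [Wm|]; last first.
  by rewrite mE /W msupD => /subset_trans; apply; apply: subsetUl.
have [<- //|ij] := eqVneq j i.
(* Two distinct generators have least common multiple [t^T], of degree [#|T|]. *)
suff sup_m : msup m = setT.
  by have := card_msup m; rewrite sup_m cardsT leqNgt lt_m.
apply/eqP; rewrite -subTset; apply/subsetP => x _.
case: (eqVneq (part x) i) => xi; last by apply: (subsetP Wm); rewrite !inE.
by rewrite mE msupD in_setU (subsetP sj) // !inE xi eq_sym.
Qed.

Lemma mp_reg_ge r : reg_bounded (Ic K e) r -> (#|T| - 2 <= r)%N.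
Proof.
case=> len [b [a [D [[_ homD aug exD] reg_a]]]].
rewrite leqNgt; apply/negP => lt_r.
have IcD j : Ic K e (D 0 ord0 j).
  apply/aug; exists (delta_mx j ord0); rewrite -colE mxE.
  by congr (D 0 _ _).
pose i0 : 'I_p.+1 := ord0.
pose D' : 'M[S]_(1, rk b 1) := map_mx (mrestr (W i0)) (D 0).
have D'E (w : 'cV[S]_(rk b 1)) m : (mdeg m < #|T|)%N ->
    ((D' *m w) ord0 ord0)@_m =
    if W i0 m then ((D 0 *m w) ord0 ord0)@_m else 0.
  move=> lt_m; rewrite !mxE !linear_sum /=.
  transitivity (\sum_j if W i0 m then (D 0 ord0 j * w j ord0)@_m else 0).
    by apply: eq_bigr => j _; rewrite mxE mcoeff_mrestr_mp.
  by case: ifP => // _; rewrite big1.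
have D'D1 : D' *m D 1 = 0.
  apply/matrixP => z k; rewrite ord1 [RHS]mxE; apply/mpolyP => m; rewrite mcoeff0.
  have [lt_m|ge_m] := ltnP (mdeg m) #|T|.
    have colD : (D 0 *m col k (D 1)) ord0 ord0 = 0.
      have -> : D 0 *m col k (D 1) = 0; last by rewrite mxE.
      by apply/exD; exists (delta_mx k ord0); rewrite colE.
    have := D'E (col k (D 1)) m lt_m; rewrite colD mcoeff0 if_same => <-.
    by rewrite colE mulmxA -colE [in RHS]mxE.
  (* The syzygies have degree at most [r + 2 < #|T|], so no monomial occurs here. *)
  rewrite mxE linear_sum big1 //= => j _; apply: memN_msupp_eq0; apply/negP.
  move=> /msuppM_le/allpairsP[[m1 m2] /= [Dm1 Dm2 mE]].
  have {}Dm1 : m1 \in msupp (D 0 ord0 j).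
    move: Dm1; rewrite !mcoeff_msupp mxE mcoeff_mrestr.
    by case: ifP => //; rewrite eqxx.
  have [D0|[_ hom1]] := homD 0%N ord0 j; first by rewrite D0 msupp0 in Dm1.
  have [D0|[le_a hom2]] := homD 1%N j k; first by rewrite D0 msupp0 in Dm2.
  have d1 : mdeg m1 = a 0%N j by have := dhomog_mf hom1 Dm1; rewrite /= subn0.
  have d2 : mdeg m2 = (a 1%N k - a 0%N j)%N := dhomog_mf hom2 Dm2.
  have := leq_trans ge_m.
  rewrite mE mdegD d1 d2 subnKC // => /(_ _ (reg_a 1%N k (ltn_ord k))).
  by rewrite leqNgt addnC -ltn_subRL lt_r.
have D'0 (w : 'cV[S]_(rk b 1)) : D 0 *m w = 0 -> D' *m w = 0.
  by move/exD => [w' ->]; rewrite mulmxA D'D1 mul0mx.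
have genP (i : 'I_p.+1) :
    exists w : 'cV[S]_(rk b 1), X (~: V i) = (D 0 *m w) ord0 ord0.
  by apply/aug/IcX/multipartite_vcoverP; exists i; rewrite msup_mset.
have [u uE] := genP i0; have [z zE] := genP ord_max.
(* The syzygy between the first and last generators; its image under [D'] has coefficient [1 - 0] at
   [t^T]. *)
have /D'0 : D 0 *m (X (V i0) *: u - X (V (@ord_max p)) *: z) = 0.
  apply/eqP; rewrite mulmxBr subr_eq0 -!scalemxAr; apply/eqP/matrixP => x y.
  by rewrite !ord1 [LHS]mxE [RHS]mxE -uE -zE !mulX_compl.
rewrite mulmxBr -!scalemxAr => /eqP; rewrite subr_eq0 => /eqP.
move/matrixP/(_ ord0 ord0).
rewrite [LHS]mxE [RHS]mxE => /(congr1 (mcoeff (mset setT))).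
rewrite -{1}(mset_compl (V i0)) -(mset_compl (V (@ord_max p))).
rewrite ![X _ * _]mulrC !mcoeffMX !D'E ?mdeg_mset ?mp_card_compl //.
rewrite -uE -zE !mcoeffX !eqxx /W !msup_mset subxx setCS.
case: ifP => [/subsetP sV|_ /eqP]; last by rewrite oner_eq0.
have [v pv] := part_surj ord_max; have := sV v; rewrite !inE pv eqxx => /(_ isT).
by rewrite gtn_eqF.
Qed.

Lemma mp_regularity : is_reg_quot (Ic K e) (#|T| - 2).
Proof.
split=> [|r /mp_reg_ge//]; exists 2, mp_rank, mp_shift, mp_diff.
by split; [apply: mp_resolution | apply: mp_shift_reg].
Qed.

End MultipartiteRegularity.

(** * The cycle of implications *)

Theorem theorem3p10 (K : fieldType) (T : finType) (e : rel T) :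
  simple_graph e -> has_edge e ->
  [<-> (* (a) *) is_vnumber (Ic K e) (#|T| - 2);
       (* (b) *) [/\ is_vnumber (Ic K e) (#|T| - 2), is_reg_quot (Ic K e) (#|T| - 2),
                     is_krull_dim_quot (Ic K e) (#|T| - 2) & codi_graph e];
       (* (c) *) (forall C : {set T}, is_vcover e C -> exchange_property e C ->
                     #|C| = (#|T| - 1)%N);
       (* (d) *) (forall A : {set T}, has_edge (induced e A) ->
                     is_vnumber (Ic K (induced e A)) (#|A| - 2));
       (* (e) *) (forall A : {set T}, has_edge (induced e A) ->
                     connected_graph (induced e A));
       (* (f) *) complete_multipartite e].
Proof.
move=> e_simple e_edge.
have vnumP (A : {set T}) : has_edge (induced e A) ->
    is_vnumber (Ic K (induced e A)) (#|A| - 2) <-> nonadj_trans (induced e A).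
  move=> eA; have A_simple := induced_simple e_simple A.
  have <- : #|{: {x : T | x \in A}}| = #|A| by rewrite card_sig; apply: eq_card.
  by rewrite is_vnumber_codim2P // nonadj_trans_sole_edge.
have vnum_star : is_vnumber (Ic K e) (#|T| - 2) <-> nonadj_trans e.
  by rewrite is_vnumber_codim2P // nonadj_trans_sole_edge.
tfae.
- move=> vnum; have /vnum_star star := vnum.
  have multi := nonadj_trans_complete_multipartite e_simple e_edge star.
  split=> //; last exact: complete_multipartite_codi.
    case: multi => -[|p] [part [// p_gt0 surj eE]].
    exact: mp_regularity p_gt0 surj eE.
  exact: Ic_krull_dim.
- case=> /vnum_star/(nonadj_trans_sole_edge e_simple) star _ _ _ C cC xC.
  have /(exchange_propertyP e_simple)[A [u [v [se ->]]]] := conj cC xC.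
  have := card_sole_edge e_simple se; have := star _ _ _ se.
  by case: se => _ uA _ _ _; rewrite cardsU1 uA; lia.
(* Non-adjacency is shown transitive on the whole graph, and induced subgraphs inherit this. *)
- move=> cov A eA; apply/vnumP => //; apply: nonadj_trans_induced.
  apply/(nonadj_trans_sole_edge e_simple) => B u v se.
  have /(exchange_propertyP e_simple)[cC xC] :
    exists A u' v', sole_edge e A u' v' /\ u |: B = u' |: A by exists B, u, v.
  have := cov _ cC xC; have := card_sole_edge e_simple se.
  by case: se => _ uB _ _ _; rewrite cardsU1 uB; lia.
- move=> vnum A eA; apply: nonadj_trans_connected => //.
    exact: induced_simple.
  exact/vnumP/vnum.
- move/(induced_connected_nonadj_trans e_simple).
  exact: nonadj_trans_complete_multipartite.
by move/complete_multipartite_nonadj_trans/vnum_star.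
Qed.
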